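(* Let $X$ be a connected finite polyhedron, $n\ge 1$, and let $f\colon X\to D_n(X)$ be an $n$-valued map. Then $$\mathrm{Fix}(f)=\bigcup_{\bar f_i} p\,\mathrm{Fix}(\bar f_i),$$ where the union is taken over the set of all lift-factors $\bar f_i\colon\tilde X\to\tilde X$ of $f$, and $\mathrm{Fix}(f)=\{x\in X\mid x\in f(x)\}$.
   Context: Let $p\colon\tilde X\to X$ be the universal covering space; $\pi_1(X)$ is identified with the group of covering transformations of $p$. $F_n(X)=\{(x_1,\dots,x_n)\in X^n\mid x_i\ne x_j \text{ for } i\ne j\}$ has the subspace topology, and $D_n(X)$, the set of $n$-element subsets of $X$, has the quotient topology as the orbit space of $F_n(X)$ under the symmetric group $\Sigma_n$. An $n$-valued map is a continuous map $f\colon X\to D_n(X)$. The orbit configuration space is $F_n(\tilde X,\pi)=\{(\tilde x_1,\dots,\tilde x_n)\in\tilde X^n\mid \tilde x_i\ne\alpha\tilde x_j \text{ for all } i\neq j,\ \alpha\in\pi_1(X)\}$, with projection $p^n\colon F_n(\tilde X,\pi)\to D_n(X)$, $p^n(\tilde x_1,\dots,\tilde x_n)=\{p(\tilde x_1),\dots,p(\tilde x_n)\}$. A lifting of $f$ is a continuous map $\bar f=(\bar f_1,\dots,\bar f_n)\colon\tilde X\to F_n(\tilde X,\pi)$ with $p^n\circ\bar f=f\circ p$. The coordinate maps $\bar f_i\colon\tilde X\to\tilde X$ of all liftings of $f$ are called the lift-factors of $f$. $\mathrm{Fix}(\bar f_i)=\{\tilde x\in\tilde X\mid\bar f_i(\tilde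 x)=\tilde x\}$. *)

(* Defs.v *)
From HB Require Import structures.
From mathcomp Require Import all_boot all_order all_algebra.
From mathcomp Require Import all_classical all_reals all_analysis.
Set Implicit Arguments.
Unset Strict Implicit.
Unset Printing Implicit Defensive.
Import Order.TTheory GRing.Theory Num.Theory numFieldNormedType.Exports.
Local Open Scope classical_set_scope.
Local Open Scope ring_scope.

Definition homeomorphism (S T : topologicalType) (f : S -> T) : Prop :=
  continuous f /\
  exists g : T -> S, [/\ continuous g, cancel f g & cancel g f].

Definition homeomorphism_on (S T : topologicalType) (A : set S) (B : set T)
    (f : S -> T) : Prop :=
  [/\ {within A, continuous f}, set_fun A B f &
   exists g : T -> S, [/\ {within B, continuous g}, set_fun B A g,
     {in A, cancel f g} & {in B, cancel g f}]].

Definition simplicial_complex (V : finType) (K : {set {set V}}) : Prop :=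
  [/\ finset.set0 \notin K,
      forall v : V, [set v]%SET \in K &
      forall s t : {set V},
        s \in K -> t != finset.set0 -> t \subset s -> t \in K].

(* Barycentric coordinates: x v is the weight of the vertex v.  The coercion of
   this set to a type carries the subspace topology of R^V. *)
Definition realization (R : realType) (V : finType) (K : {set {set V}}) :
    set {ptws V -> R} :=
  [set x | [/\ forall v, 0 <= x v, \sum_(v : V) x v = 1 &
               [set v | x v != 0]%SET \in K]].

Arguments realization R {V} K.

Definition finite_polyhedron (R : realType) (X : topologicalType) : Prop :=
  exists (V : finType) (K : {set {set V}}), simplicial_complex K /\
  exists h : X -> realization R K, homeomorphism h.

Definition path_from_to (R : realType) (T : topologicalType) (x y : T)
    (c : R -> T) : Prop :=
  [/\ {within `[0, 1]%classic, continuous c}, c 0 = x & c 1 = y].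

(* Homotopy relative to the endpoints. *)
Definition path_homotopic (R : realType) (T : topologicalType)
    (c d : R -> T) : Prop :=
  exists H : R * R -> T,
  [/\ {within `[0, 1]%classic `*` `[0, 1]%classic, continuous H},
      forall s : R, s \in `[0, 1] -> H (s, 0) = c s /\ H (s, 1) = d s &
      forall t : R, t \in `[0, 1] -> H (0, t) = c 0 /\ H (1, t) = c 1].

Definition path_connected (R : realType) (T : topologicalType) : Prop :=
  forall x y : T, exists c : R -> T, path_from_to x y c.

Definition simply_connected (R : realType) (T : topologicalType) : Prop :=
  [/\ [set: T] !=set0, path_connected R T &
      forall (x : T) (c : R -> T),
        path_from_to x x c -> path_homotopic c (fun=> x)].

Definition evenly_covered (E X : topologicalType) (p : E -> X) (U : set X) :
    Prop :=
  exists (I : Type) (V : I -> set E),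
  [/\ forall i, open (V i), trivIset [set: I] V,
      p @^-1` U = \bigcup_i V i & forall i, homeomorphism_on (V i) U p].

Definition covering_map (E X : topologicalType) (p : E -> X) : Prop :=
  [/\ continuous p, set_surj [set: E] [set: X] p &
      forall x : X, exists U : set X, [/\ open U, U x & evenly_covered p U]].

Definition universal_covering (R : realType) (E X : topologicalType)
    (p : E -> X) : Prop :=
  covering_map p /\ simply_connected R E.

Definition covering_transformation (E X : topologicalType) (p : E -> X)
    (a : E -> E) : Prop :=
  homeomorphism a /\ p \o a = p.

Definition config (n : nat) (X : topologicalType) : set {ptws 'I_n -> X} :=
  [set x | forall i j : 'I_n, i != j -> x i <> x j].
Arguments config : clear implicits.

Definition unordered_config (n : nat) (X : topologicalType) : Type :=
  set_type [set A : set X | (A #= `I_n)%card].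

HB.instance Definition _ (n : nat) (X : topologicalType) :=
  gen_eqMixin (unordered_config n X).
HB.instance Definition _ (n : nat) (X : topologicalType) :=
  gen_choiceMixin (unordered_config n X).

Definition points (n : nat) (X : topologicalType) (A : unordered_config n X) :
  set X := val A.

Lemma config_card (n : nat) (X : topologicalType) (x : config n X) :
  range (val x) \in [set A : set X | (A #= `I_n)%card].
Proof.
apply/mem_set => /=; have /set_mem xP := valP x.
have xinj : {in [set: 'I_n] &, injective (val x)}.
  by move=> i j _ _ xij; have [//|/xP] := eqVneq i j.
apply: (card_eq_trans (inj_card_eq xinj)).
apply/card_set_bijP; exists (@nat_of_ord n); split => //=.
- by move=> i _; exact: ltn_ord.
- by move=> i j _ _ /val_inj.
- by move=> k kn; exists (Ordinal kn).
Qed.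

Definition forget_order (n : nat) (X : topologicalType) (x : config n X) :
  unordered_config n X := exist _ (range (val x)) (config_card x).

(* The quotient topology; the fibres of forget_order are the orbits of the
   symmetric group permuting the coordinates. *)
Section UnorderedConfigTopology.
Variables (n : nat) (X : topologicalType).

Definition unordered_open (U : set (unordered_config n X)) : Prop :=
  open (@forget_order n X @^-1` U).

Lemma unordered_openT : unordered_open setT.
Proof. by rewrite /unordered_open preimage_setT; exact: openT. Qed.

Lemma unordered_openI : setI_closed unordered_open.
Proof. by move=> A B; exact: openI. Qed.

Lemma unordered_open_bigU (I : Type) (A : I -> set (unordered_config n X)) :
  (forall i, unordered_open (A i)) -> unordered_open (\bigcup_i A i).
Proof. by move=> oA; apply: bigcup_open => i _; exact: oA. Qed.

HB.instance Definition _ := isOpenTopological.Build (unordered_config n X)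
  unordered_openT unordered_openI unordered_open_bigU.
End UnorderedConfigTopology.

Definition orbit_config (n : nat) (E X : topologicalType) (p : E -> X) :
    set {ptws 'I_n -> E} :=
  [set x | forall (i j : 'I_n) (a : E -> E), i != j ->
     covering_transformation p a -> x i <> a (x j)].
Arguments orbit_config n {E X} p.

(* The projection p^n, valued in all subsets of X: that its values have
   exactly n elements depends on the covering transformations acting
   transitively on the fibres of p. *)
Definition orbit_config_proj (n : nat) (E X : topologicalType) (p : E -> X)
    (x : orbit_config n p) : set X :=
  [set p (val x i) | i in [set: 'I_n]].

Definition lifting (n : nat) (E X : topologicalType) (p : E -> X)
    (f : X -> unordered_config n X) (fbar : E -> orbit_config n p) : Prop :=
  continuous fbar /\
  forall x : E, orbit_config_proj (fbar x) = points (f (p x)).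

Definition lift_factors (n : nat) (E X : topologicalType) (p : E -> X)
    (f : X -> unordered_config n X) : set (E -> E) :=
  [set g | exists (fbar : E -> orbit_config n p) (i : 'I_n),
     lifting f fbar /\ g = (fun x => val (fbar x) i)].

Definition Fix (T : Type) (g : T -> T) : set T := [set x | g x = x].

Definition Fix_multi (n : nat) (X : topologicalType)
    (f : X -> unordered_config n X) : set X :=
  [set x | points (f x) x].

(* Main.v *)
Require Import Defs.
From mathcomp Require Import all_boot all_order all_algebra.
From mathcomp Require Import all_classical all_reals all_analysis.
From mathcomp Require Import lra.
Set Implicit Arguments.
Unset Strict Implicit.
Unset Printing Implicit Defensive.
Import Order.TTheory GRing.Theory Num.Theory numFieldNormedType.Exports.
Local Open Scope ring_scope.
Local Open Scope classical_set_scope.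

(** A fixed point of a lift-factor [g] projects to a fixed point of [f] because
    [p (g y)] is one of the points of [f (p y)] for every [y].  The content is
    the converse: given [x = p y0] in [f x], a lifting of [f] must be found one
    of whose coordinates fixes [y0].

    The set-valued map [W y = {e | p e in f (p y)}] on the universal covering
    space is a covering in disguise: its graph is locally a disjoint union of
    graphs of continuous functions ([sheeted_lift_relation]).  Indeed, near a
    point of [X] the [n] values of [f] vary inside [n] disjoint evenly covered
    open sets, and each value is lifted to every sheet over its open set.
    The base of [W] being simply connected and locally path connected, through
    every point of the graph of [W] passes a global continuous section
    ([global_section]).  The point [y0] belongs to [W y0]; taking the
    section through [(y0, y0)], and one section through a preimage of each of
    the other [n - 1] points of [f x], gives [n] maps.  Their projections to [X]
    are sections of the covering [y |-> f (p y)], so that, being distinct at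
    [y0], they are distinct everywhere ([global_section_unique]) and exhaust
    [f (p y)] by counting ([points_range]).  Hence the [n] maps form a lifting,
    and the coordinate chosen first fixes [y0].

    The global section is obtained by monodromy: sections exist over any
    rectangle of the plane ([sheeted_rectangle]), so paths and homotopies lift,
    and the end point of a lifted path depends only on the end point of the
    path ([simply_connected_monodromy]).  Local path connectedness is inherited
    from the polyhedron, where a point is joined to the nearby ones by
    straight segments ([locally_joinable_realization]). *)

(** * Sections of coverings given by their fibres *)

Lemma within_continuousP (T U : topologicalType) (A : set T) (g : T -> U) :
  {within A, continuous g} <->
  forall x, A x -> forall O, nbhs (g x) O -> \forall y \near x, A y -> O (g y).
Proof. by rewrite subspace_continuousP. Qed.

Lemma continuous_comp_within (S T U : topologicalType) (A : set T)
    (f : S -> T) (g : T -> U) :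
  continuous f -> (forall x, A (f x)) -> {within A, continuous g} ->
  continuous (g \o f).
Proof.
move=> cf fA /within_continuousP cg x O /= /(cg _ (fA x)) gO.
have fO : nbhs x (f @^-1` [set y | A y -> O (g y)]) := cf x _ gO.
by apply: filterS fO => y /=; apply.
Qed.

Lemma connected_locally_constant (T : topologicalType) (A : set T)
    (P : T -> Prop) :
  connected A ->
  (forall x, A x -> \forall y \near x, A y -> (P y <-> P x)) ->
  forall x y, A x -> A y -> P x -> P y.
Proof.
move=> cA lcP x y Ax Ay Px.
suff AP : A `&` P = A by move: Ay; rewrite -AP => -[].
apply: cA; first by exists x.
- exists (interior [set z | A z -> P z]); first exact: open_interior.
  rewrite eqEsubset; split=> z [Az] /=; last by move=> /nbhs_singleton /(_ Az).
  move=> Pz; split=> //.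
  by apply: filterS (lcP _ Az) => w /= + Aw => /(_ Aw) [_]; apply.
- exists (~` interior [set z | A z -> ~ P z]).
    exact/open_closedC/open_interior.
  rewrite eqEsubset; split=> z [Az] /=.
    by move=> Pz; split=> // /nbhs_singleton /(_ Az).
  move=> nPz; split=> //; apply: contrapT => nP; apply: nPz.
  by apply: filterS (lcP _ Az) => w /= + Aw => /(_ Aw) [Pwz _] /Pwz.
Qed.

Section Sheeted.
Variables (Y E : topologicalType).
Implicit Types (W : Y -> set E) (A : set Y) (s : Y -> E).

(** A covering space of [Y] given by its fibres [W y], all sitting in one space
    [E].  The first clause says that the projection of the graph of [W] to [Y]
    is open; the second one that it is locally trivial, a label [l]
    telling the sheets over [N] apart.  Openness is what makes the sheets
    graphs of continuous functions. *)
Definition sheeted W : Prop :=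
  (forall y e O, W y e -> nbhs e O ->
     \forall y' \near y, exists2 e', W y' e' & O e') /\
  forall y : Y, exists (N : set Y) (K : Type) (l : E -> K),
    [/\ nbhs y N,
        forall z e, N z -> W z e -> \forall e' \near e, l e' = l e,
        forall z e z', N z -> N z' -> W z e -> exists2 e', W z' e' & l e' = l e &
        forall z e e', N z -> W z e -> W z e' -> l e = l e' -> e = e'].

Definition section_on W A s : Prop :=
  {within A, continuous s} /\ forall y, A y -> W y (s y).

Definition has_sections W A : Prop :=
  forall y e, A y -> W y e -> exists2 s, section_on W A s & s y = e.

Lemma section_onW W A B s : A `<=` B -> section_on W B s -> section_on W A s.
Proof.
by move=> AB [cs Ws]; split=> [|y /AB]; [exact: continuous_subspaceW AB cs|exact: Ws].
Qed.

Lemma has_sectionsW W A B : A `<=` B -> has_sections W B -> has_sections W A.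
Proof.
move=> AB hB y e /AB By Wye; have [s sB <-] := hB _ _ By Wye.
by exists s => //; exact: section_onW AB sB.
Qed.

(** Over a trivializing neighbourhood two sections agree exactly where their
    labels agree, and the labels are locally constant. *)
Lemma section_unique W A s t y :
  sheeted W -> connected A -> section_on W A s -> section_on W A t ->
  A y -> s y = t y -> {in A, s =1 t}.
Proof.
move=> [_ sh] cA [/within_continuousP cs Ws] [/within_continuousP ct Wt] Ay sty.
move=> z /set_mem Az.
apply: (connected_locally_constant (P := fun x => s x = t x) cA _ Ay Az sty).
move=> x Ax; have [N [K [l [Nx lc _ linj]]]] := sh x.
have Nxx := nbhs_singleton Nx.
have ls := cs x Ax _ (lc _ _ Nxx (Ws _ Ax)).
have lt := ct x Ax _ (lc _ _ Nxx (Wt _ Ax)).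
near=> w => Aw.
have lsw : l (s w) = l (s x) by move: Aw; near: w.
have ltw : l (t w) = l (t x) by move: Aw; near: w.
have Nw : N w by near: w.
split=> [e|e].
  by apply: (linj x) => //; [exact: Ws|exact: Wt|rewrite -lsw e].
by apply: (linj w) => //; [exact: Ws|exact: Wt|rewrite lsw e].
Unshelve. all: by end_near. Qed.

(** The section through [e] picks in each fibre the point with the same label
    as [e]; points near its value are labelled alike, which turns openness of
    the projection into continuity. *)
Lemma sheeted_local_sections W (y : Y) :
  sheeted W -> exists2 N : set Y, nbhs y N & has_sections W N.
Proof.
move=> [lsc /(_ y) [N [K [l [Ny lc lsurj linj]]]]]; exists N => // z e Nz Wze.
have /choice [s sP] : forall x, exists e', N x -> W x e' /\ l e' = l e.
  move=> x; have [Nx|nNx] := pselect (N x); last by exists e.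
  by have [e' We' le'] := lsurj _ _ _ Nz Nx Wze; exists e'.
exists s; last first.
  have [Ws ls] := sP _ Nz; exact: (linj z).
split=> [|x /sP []//]; apply/within_continuousP => x Nx O sO.
have [Wsx lsx] := sP _ Nx.
have lO : nbhs (s x) (O `&` [set e' | l e' = l (s x)]).
  by apply: filterI => //; exact: lc Nx Wsx.
have := lsc _ _ _ Wsx lO.
apply: filterS => w [e' We' [Oe' le']] Nw; have [Wsw lsw] := sP _ Nw.
suff -> : s w = e' by [].
by apply: (linj w) => //; rewrite lsw le'.
Qed.

(** A section over one piece is continued over the other one from a common
    point; the two agree on the whole intersection because it is connected. *)
Lemma has_sectionsU W A B :
  sheeted W -> closed A -> closed B -> A `&` B !=set0 -> connected (A `&` B) ->
  has_sections W A -> has_sections W B -> has_sections W (A `|` B).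
Proof.
move=> shW clA clB AB0 cAB hA hB y e.
wlog Ay : A B clA clB AB0 cAB hA hB / A y.
  move=> wl ABy; case: (ABy) => [Ay|By]; first exact: wl.
  by rewrite setUC; apply: wl; rewrite // 1?setIC // setUC.
move=> _ Wye.
have [s [cs Ws] sy] := hA _ _ Ay Wye; have [w [Aw Bw]] := AB0.
have [t [ct Wt] tw] := hB _ _ Bw (Ws _ Aw).
have st : {in A `&` B, s =1 t}.
  apply: (@section_unique W (A `&` B) s t w) => //.
    by apply: (@section_onW W _ A) => //; exact: subIsetl.
  by apply: (@section_onW W _ B) => //; exact: subIsetr.
pose u x := if x \in A then s x else t x.
have uA : {in A, s =1 u} by move=> x xA; rewrite /u xA.
have uB : {in B, t =1 u}.
  move=> x /set_mem Bx; rewrite /u; case: ifPn => // /set_mem Ax.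
  by rewrite st //; exact/mem_set.
exists u; last by rewrite -uA //; exact/mem_set.
split=> [|x [Ax|Bx]]; first apply: withinU_continuous => //.
- by apply: subspace_eq_continuous cs => x /uA.
- by apply: subspace_eq_continuous ct => x /uB.
- by rewrite -uA; [exact: Ws|exact/mem_set].
- by rewrite -uB; [exact: Wt|exact/mem_set].
Qed.

End Sheeted.

Lemma sheeted_comp (Z Y E : topologicalType) (W : Y -> set E) (h : Z -> Y) :
  continuous h -> sheeted W -> sheeted (W \o h).
Proof.
move=> ch [lsc sh]; split=> [z e O Wze eO|z].
  exact: (ch z _ (lsc _ _ _ Wze eO)).
have [N [K [l [Nz lc ls li]]]] := sh (h z).
exists (h @^-1` N), K, l; split; first exact: ch.
- by move=> w e Nw; exact: lc.
- by move=> w e w' Nw Nw'; exact: ls.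
- by move=> w e e' Nw; exact: li.
Qed.

(** * Coverings of rectangles *)

(** Cousin's lemma, which replaces subdivisions finer than a Lebesgue number:
    a property of intervals that holds on the small ones near each point and
    passes to concatenations holds on all intervals.  The supremum of the [t] with
    [P a t] can only be [b]. *)
Lemma interval_subdivision (R : realType) (P : R -> R -> Prop) :
  (forall a b c, a <= b -> b <= c -> P a b -> P b c -> P a c) ->
  (forall x, exists2 e, 0 < e &
     forall a b, x - e < a -> a <= b -> b < x + e -> P a b) ->
  forall a b, a <= b -> P a b.
Proof.
move=> glue loc a b ab.
pose A := [set t | a <= t <= b /\ P a t].
have Aa : A a.
  have [e e0 Pe] := loc a; split; first by rewrite lexx.
  by apply: Pe; lra.
have supA : has_sup A.
  by split; [exists a|exists b => t [/andP[_ tb] _]].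
set s := sup A.
have as_ : a <= s by exact: ub_le_sup supA.2 _ Aa.
have [e e0 Pe] := loc s.
have [t [/andP[ta tb] Pat] st] := sup_adherent e0 supA.
have ts : t <= s by apply: ub_le_sup; [exact: supA.2|split=> //; apply/andP].
pose m := Num.min b (s + e / 2).
have mb : m <= b by rewrite /m ge_min lexx.
have ms : m <= s + e / 2 by rewrite /m ge_min lexx orbT.
have tm : t <= m by rewrite /m le_min tb /=; lra.
have Am : A m.
  split; first by rewrite mb (le_trans ta tm).
  by apply: (glue _ t) => //; apply: Pe => //; lra.
have ms' : m <= s by exact: ub_le_sup supA.2 _ Am.
have mE : m = b.
  rewrite /m; apply/min_idPl; rewrite leNgt; apply/negP => sb.
  by move: ms'; rewrite /m (min_idPr (ltW sb)); lra.
by rewrite -mE; exact: Am.2.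
Qed.

Lemma continuous_fun_pair (S T U : topologicalType) (f : S -> T) (g : S -> U) :
  continuous f -> continuous g -> continuous (fun x => (f x, g x)).
Proof. by move=> cf cg x; exact: cvg_pair (cf x) (cg x). Qed.

Section Rectangles.
Variables (R : realType) (E : topologicalType).

Lemma closed_rectangle (a b c d : R) : closed (`[a, b] `*` `[c, d]).
Proof.
have -> : `[a, b] `*` `[c, d] = (@fst R R) @^-1` `[a, b] `&` (@snd R R) @^-1` `[c, d].
  by [].
apply: closedI.
  apply: (@preimage_closed (R * R)%type R fst `[a, b]); last exact: itv_closed.
  by move=> ? _; exact: cvg_fst.
apply: (@preimage_closed (R * R)%type R snd `[c, d]); last exact: itv_closed.
by move=> ? _; exact: cvg_snd.
Qed.

(** Rectangles can be subdivided in one direction and then in the other, since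
    pasting two rectangles along a common edge preserves the existence of
    sections. *)
Lemma sheeted_rectangle (W : R * R -> set E) : sheeted W ->
  forall a b c d, a <= b -> c <= d -> has_sections W (`[a, b] `*` `[c, d]).
Proof.
move=> shW a b c d ab cd.
have conn0 (x u v : R) (S : set (R * R)) :
  (fun t : R => (x, t)) @` `[u, v] = S -> connected S.
  move=> <-; apply: connected_continuous_connected; first exact: segment_connected.
  apply: continuous_subspaceT; apply: continuous_fun_pair;
    by [move=> t; exact: cvg_cst|move=> t; exact: cvg_id].
have conn1 (x u v : R) (S : set (R * R)) :
  (fun t : R => (t, x)) @` `[u, v] = S -> connected S.
  move=> <-; apply: connected_continuous_connected; first exact: segment_connected.
  apply: continuous_subspaceT; apply: continuous_fun_pair;
    by [move=> t; exact: cvg_cst|move=> t; exact: cvg_id].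
apply: (interval_subdivision
  (P := fun c d => has_sections W (`[a, b] `*` `[c, d]))) cd => {c d} [c d e cd de h1 h2|x].
  have -> : `[a, b] `*` `[c, e] = `[a, b] `*` `[c, d] `|` `[a, b] `*` `[d, e].
    rewrite eqEsubset; split=> -[t w] /=; rewrite !in_itv/=.
      by case=> tab; case: (leP w d) => td /andP[ct te]; [left|right];
        split=> //; apply/andP; split=> //; exact: ltW.
    by case=> -[tab /andP[h h']]; split=> //; apply/andP; split; lra.
  have I : `[a, b] `*` `[c, d] `&` `[a, b] `*` `[d, e] = `[a, b] `*` [set d].
    rewrite eqEsubset; split=> -[t w] /=; rewrite !in_itv/=.
      by case=> -[tab /andP[? ?]] [_ /andP[? ?]];
        split=> //; apply/eqP; rewrite eq_le; apply/andP.
    by case=> tab ->; rewrite !lexx cd de.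
  apply: has_sectionsU => //; rewrite ?I; try exact: closed_rectangle.
    by exists (a, d); split; rewrite //= in_itv /= lexx.
  apply: (@conn1 d a b); rewrite eqEsubset; split=> [_ [t tab <-]|[t u] /= [tab ->]] //.
  by exists t.
(* A thin strip around the height [x], covered by small rectangles. *)
suff [e e0 He] : exists2 e, 0 < e & forall c d, x - e < c -> c <= d -> d < x + e ->
    has_sections W (`[a, b] `*` `[c, d]) by exists e.
apply: (interval_subdivision (P := fun a b => exists2 e, 0 < e &
    forall c d, x - e < c -> c <= d -> d < x + e ->
    has_sections W (`[a, b] `*` `[c, d]))) ab => {a b} [a b c ab bc [e e0 he] [f f0 hf]|y].
  exists (Num.min e f) => [|u v xu uv vx]; first by rewrite /= lt_min e0.
  have me : Num.min e f <= e by rewrite ge_min lexx.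
  have mf : Num.min e f <= f by rewrite ge_min lexx orbT.
  have hu : has_sections W (`[a, b] `*` `[u, v]) by apply: he => //; lra.
  have hu' : has_sections W (`[b, c] `*` `[u, v]) by apply: hf => //; lra.
  have -> : `[a, c] `*` `[u, v] = `[a, b] `*` `[u, v] `|` `[b, c] `*` `[u, v].
    rewrite eqEsubset; split=> -[t w] /=; rewrite !in_itv/=.
      by case=> + tab; case: (leP t b) => td /andP[ct te]; [left|right];
        split=> //; apply/andP; split=> //; exact: ltW.
    by case=> -[/andP[h h'] tab]; split=> //; apply/andP; split; lra.
  have I : `[a, b] `*` `[u, v] `&` `[b, c] `*` `[u, v] = [set b] `*` `[u, v].
    rewrite eqEsubset; split=> -[t w] /=; rewrite !in_itv/=.
      by case=> -[/andP[? ?] tab] [/andP[? ?] _];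
        split=> //; apply/eqP; rewrite eq_le; apply/andP.
    by case=> -> tab; rewrite !lexx ab bc.
  apply: has_sectionsU => //; rewrite ?I; try exact: closed_rectangle.
    by exists (b, u); split; rewrite //= in_itv /= lexx.
  apply: (@conn0 b u v); rewrite eqEsubset.
  by split=> [_ [t tab <-]|[t w] /= [-> tab]] //; exists w.
have [N /nbhs_ballP [e /= e0 eN] hN] := sheeted_local_sections (y, x) shW.
exists e => // a b ya ab yb; exists e => // c d xc cd xd.
apply: has_sectionsW hN => -[t u] /= []; rewrite !in_itv /= => /andP[? ?] /andP[? ?].
apply: eN; split; rewrite -ball_normE /= ltr_distlC; apply/andP; split; lra.
Qed.

End Rectangles.

(** * Paths and monodromy *)

(** The retraction of the line onto [`[0, 1]].  It turns paths and homotopies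
    continuous on the unit interval or square into globally continuous maps. *)
Definition clamp (R : realType) (t : R) : R := (1 + `|t| - `|t - 1|) / 2.

Lemma clamp_id (R : realType) (t : R) : `[0, 1] t -> clamp t = t.
Proof.
rewrite /= in_itv /= => /andP[t0 t1]; rewrite /clamp ger0_norm // ler0_norm; lra.
Qed.

Lemma clamp_itv (R : realType) (t : R) : `[0, 1] (clamp t).
Proof.
rewrite /= in_itv /= /clamp.
by have [t0|t0] := ger0P t; have [t1|t1] := ger0P (t - 1); apply/andP; split; lra.
Qed.

Lemma clamp0 (R : realType) : clamp 0 = 0 :> R.
Proof. by rewrite clamp_id //= in_itv /= lexx ler01. Qed.

Lemma clamp1 (R : realType) : clamp 1 = 1 :> R.
Proof. by rewrite clamp_id //= in_itv /= lexx ler01. Qed.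

Lemma continuous_clamp (R : realType) : continuous (@clamp R).
Proof.
move=> t; apply: cvgMl; apply: cvgB; first apply: cvgD.
- exact: cvg_cst.
- exact: norm_continuous.
- apply: (cvg_norm (f := fun t : R => t - 1)); apply: cvgB; [exact: cvg_id|exact: cvg_cst].
Qed.

Lemma continuous_clamp2 (R : realType) :
  continuous (fun z : R * R => (clamp z.1, clamp z.2)).
Proof.
apply: continuous_fun_pair => z; apply: continuous_comp; try exact: continuous_clamp.
- exact: cvg_fst.
- exact: cvg_snd.
Qed.

Section Paths.
Variable R : realType.

Definition path_in (T : topologicalType) (A : set T) (x y : T) : Prop :=
  exists c : R -> T, [/\ continuous c, forall t, A (c t), c 0 = x & c 1 = y].

Lemma path_in_sym (T : topologicalType) (A : set T) x y :
  path_in A x y -> path_in A y x.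
Proof.
move=> [c [cc Ac c0 c1]]; exists (fun t => c (1 - t)); split=> //.
- move=> t; apply: (continuous_comp (f := fun t : R => 1 - t)); last exact: cc.
  by apply: cvgB; [exact: cvg_cst|exact: cvg_id].
- by rewrite subr0.
- by rewrite subrr.
Qed.

Lemma path_in_trans (T : topologicalType) (A : set T) y x z :
  path_in A x y -> path_in A y z -> path_in A x z.
Proof.
move=> [c [cc Ac c0 c1]] [d [cd Ad d0 d1]].
pose u t := c (2 * t); pose v t := d (2 * t - 1).
pose w t := if t <= 1 / 2 then u t else v t.
have cu : continuous u.
  move=> t; apply: (continuous_comp (f := fun t : R => 2 * t)); last exact: cc.
  by apply: cvgMr; exact: cvg_id.
have cv : continuous v.
  move=> t; apply: (continuous_comp (f := fun t : R => 2 * t - 1)); last exact: cd.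
  by apply: cvgB; [apply: cvgMr; exact: cvg_id|exact: cvg_cst].
exists w; split; last 2 first.
- by rewrite /w ifT ?/u ?mulr0 //; lra.
- by rewrite /w ifF ?/v; [rewrite -d1; congr d; lra|apply/negbTE; rewrite -ltNge; lra].
- apply/continuous_subspace_setT.
  have -> : setT = `]-oo, 1 / 2] `|` `[1 / 2, +oo[ :> set R.
    rewrite eqEsubset; split=> // t _ /=; rewrite !in_itv /= andbT.
    by case: (leP t (1 / 2)) => h; [left|right; exact: ltW].
  apply: withinU_continuous; try exact: interval_closed.
    have cu' : {within `]-oo, 1 / 2], continuous u} by exact: continuous_subspaceT.
    apply: subspace_eq_continuous cu'.
    by move=> t /set_mem /=; rewrite in_itv /from_subspace /w /= => ->.
  have cv' : {within `[1 / 2, +oo[, continuous v} by exact: continuous_subspaceT.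
  apply: subspace_eq_continuous cv'.
  move=> t /set_mem /=; rewrite in_itv /from_subspace /w /= andbT => th.
  case: ifPn => // ht.
  have -> : t = 1 / 2 by apply/eqP; rewrite eq_le ht.
  have h1 : 2 * (1 / 2) = 1 :> R by lra.
  by rewrite /u /v h1 subrr d0 c1.
- by move=> t; rewrite /w; case: ifP => _; [exact: Ac|exact: Ad].
Qed.

Lemma path_connected_path_in (T : topologicalType) (x y : T) :
  path_connected R T -> path_in setT x y.
Proof.
move=> /(_ x y) [c [cc c0 c1]].
exists (c \o @clamp R); split=> //=; rewrite ?clamp0 ?clamp1 //.
exact: (continuous_comp_within (@continuous_clamp R) (@clamp_itv R) cc).
Qed.

(** Local path connectedness in a weak form that passes easily
    to covering spaces: the path may leave the set where [y] ranges, as long as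
    it stays in [N]. *)
Definition locally_joinable (T : topologicalType) : Prop :=
  forall (x : T) N, nbhs x N -> \forall y \near x, path_in N x y.

End Paths.

Section Monodromy.
Variables (R : realType) (Y E : topologicalType) (W : Y -> set E).
Hypothesis shW : sheeted W.

Definition total_space : set (Y * E) := [set z | W z.1 z.2].

Lemma square_lift (H : R * R -> Y) e :
  continuous H -> W (H (0, 0)) e ->
  exists G : R * R -> E, [/\ continuous G, G (0, 0) = e &
    forall s t, W (H (clamp s, clamp t)) (G (s, t))].
Proof.
move=> cH We; have Q : (`[0, 1] `*` `[0, 1]) ((0, 0) : R * R).
  by split; rewrite /= in_itv /= lexx ler01.
have [G [cG WG] G0] :=
  sheeted_rectangle (sheeted_comp cH shW) ler01 ler01 Q We.
exists (fun z => G (clamp z.1, clamp z.2)); split.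
- apply: (continuous_comp_within (@continuous_clamp2 R) _ cG) => z.
  by split; exact: clamp_itv.
- by rewrite /= clamp0.
- by move=> s t; apply: WG; split; exact: clamp_itv.
Qed.

(** This is [section_unique] for the covering pulled back along [c]. *)
Lemma lift_unique (c : R -> Y) (g h : R -> E) :
  continuous c -> continuous g -> continuous h ->
  (forall t, `[0, 1] t -> W (c t) (g t)) ->
  (forall t, `[0, 1] t -> W (c t) (h t)) -> g 0 = h 0 -> g 1 = h 1.
Proof.
move=> cc cg ch Wg Wh gh.
have I0 : `[0, 1] (0 : R) by rewrite /= in_itv /= lexx ler01.
have I1 : `[0, 1] (1 : R) by rewrite /= in_itv /= lexx ler01.
apply: (section_unique (sheeted_comp cc shW) (@segment_connected R 0 1) _ _ I0 gh);
  last exact/mem_set.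
  by split=> //; exact: continuous_subspaceT.
by split=> //; exact: continuous_subspaceT.
Qed.

Lemma global_section_unique (s t : Y -> E) y y' :
  path_connected R Y -> continuous s -> continuous t ->
  (forall z, W z (s z)) -> (forall z, W z (t z)) -> s y = t y -> s y' = t y'.
Proof.
move=> pc cs ct Ws Wt sty.
have [c [cc _ c0 c1]] := path_connected_path_in y y' pc.
rewrite -c1; apply: (lift_unique (g := s \o c) (h := t \o c) cc) => //=.
- by move=> r; apply: continuous_comp; [exact: cc|exact: cs].
- by move=> r; apply: continuous_comp; [exact: cc|exact: ct].
- by rewrite c0.
Qed.

Lemma path_lift (y y' : Y) e : path_in R setT y y' -> W y e ->
  exists e', path_in R total_space (y, e) (y', e').
Proof.
move=> [c [cc _ <- <-]] We.
have [|G [cG G0 WG]] := @square_lift (c \o fst) e _ We.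
  by move=> z; apply: continuous_comp; [exact: cvg_fst|exact: cc].
exists (G (1, 0)), (fun t => (c (clamp t), G (t, 0))); split.
- apply: continuous_fun_pair => t.
    by apply: continuous_comp; [exact: continuous_clamp|exact: cc].
  apply: (continuous_comp (f := fun t : R => (t, 0 : R))); last exact: cG.
  exact: cvg_pair (@cvg_id _ _) (cvg_cst _).
- by move=> t; exact: WG.
- by rewrite clamp0 G0.
- by rewrite clamp1.
Qed.

(** A lifted loop is closed: lift a null-homotopy of the loop.  On the three
    other sides of the square the homotopy is constant, hence so is its lift,
    and it takes the same value at both ends of the first side. *)
Lemma simply_connected_monodromy y e e' : simply_connected R Y ->
  path_in R total_space (y, e) (y, e') -> e = e'.
Proof.
move=> [_ _ null] [c [cc Wc c0 c1]].
pose b t := (c t).1; pose g t := (c t).2.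
have cb : continuous b by move=> t; apply: continuous_comp; [exact: cc|exact: cvg_fst].
have cg : continuous g by move=> t; apply: continuous_comp; [exact: cc|exact: cvg_snd].
have b0 : b 0 = y by rewrite /b c0.
have b1 : b 1 = y by rewrite /b c1.
have g0 : g 0 = e by rewrite /g c0.
have g1 : g 1 = e' by rewrite /g c1.
have [|H [cH Hs Ht]] := null y b.
  by split=> //; exact: continuous_subspaceT.
pose H' z := H (clamp z.1, clamp z.2).
have cH' : continuous H'.
  apply: (continuous_comp_within (@continuous_clamp2 R) _ cH) => z.
  by split; exact: clamp_itv.
have I0 : `[0, 1] (0 : R) by rewrite /= in_itv /= lexx ler01.
have I1 : `[0, 1] (1 : R) by rewrite /= in_itv /= lexx ler01.
have Wye : W (H' (0, 0)) e.
  by rewrite /H' /= clamp0 (Hs 0 I0).1 b0 -g0 -b0; exact: Wc.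
have [G [cG G0 WG]] := square_lift cH' Wye.
have W'G s t : `[0, 1] s -> `[0, 1] t -> W (H (s, t)) (G (s, t)).
  by move=> hs ht; have := WG s t; rewrite /H' /= !clamp_id.
have cGs s : continuous (fun t => G (s, t)).
  move=> t; apply: (continuous_comp (f := fun t : R => (s, t))); last exact: cG.
  exact: cvg_pair (cvg_cst _) (@cvg_id _ _).
have cGt t : continuous (fun s => G (s, t)).
  move=> s; apply: (continuous_comp (f := fun s : R => (s, t))); last exact: cG.
  exact: cvg_pair (@cvg_id _ _) (cvg_cst _).
have ccst (T : topologicalType) (x : T) : continuous (fun _ : R => x).
  by move=> ?; exact: cvg_cst.
(* Along the side [t = 0] of the square the lift [G] is the given one. *)
have E1 : g 1 = G (1, 0).
  apply: (lift_unique (h := fun s => G (s, 0)) cb cg (cGt 0)) => [t _|t It|].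
  - exact: Wc.
  - by rewrite -(Hs t It).1; exact: W'G.
  - by rewrite g0 G0.
(* Along each other side it lifts a constant path, as a constant map does. *)
have E2 : G (1, 0) = G (1, 1).
  apply: esym; apply: (lift_unique (g := fun t => G (1, t)) (ccst _ y) (cGs 1) (ccst _ _))
    => [t It|t It|//].
    by rewrite -b1 -(Ht t It).2; exact: W'G.
  by rewrite -b1 -(Ht 0 I0).2; exact: W'G.
have E3 : G (0, 0) = G (0, 1).
  apply: esym; apply: (lift_unique (g := fun t => G (0, t)) (ccst _ y) (cGs 0) (ccst _ _))
    => [t It|t It|//].
    by rewrite -b0 -(Ht t It).1; exact: W'G.
  by rewrite -b0 -(Ht 0 I0).1; exact: W'G.
have E4 : G (0, 1) = G (1, 1).
  apply: esym; apply: (lift_unique (g := fun t => G (t, 1)) (ccst _ y) (cGt 1) (ccst _ _))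
    => [t It|t It|//].
    by rewrite -(Hs t It).2; exact: W'G.
  by rewrite -(Hs 0 I0).2; exact: W'G.
by rewrite -g1 E1 E2 -E4 -E3 G0.
Qed.

(** The value at [y] is the end of a lift of any path from [y0] to [y].  Near [y]
    this map agrees with the local section through its value at [y], because
    composing that local section with a short path yields a lift. *)
Lemma global_section y0 e0 : simply_connected R Y -> locally_joinable R Y ->
  W y0 e0 -> exists s : Y -> E, [/\ continuous s, forall y, W y (s y) & s y0 = e0].
Proof.
move=> sc lj W0.
have pc y : path_in R setT y0 y by apply: path_connected_path_in; case: sc.
have /choice [s sP] : forall y, exists e, path_in R total_space (y0, e0) (y, e).
  by move=> y; exact: path_lift.
have Ws y : W y (s y).
  by have [c [_ Wc _ c1]] := sP y; have := Wc 1; rewrite /total_space /= c1.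
exists s; split=> //; last first.
  exact/esym/(simply_connected_monodromy sc (sP y0)).
move=> y O sO.
have [N Ny /(_ _ _ (nbhs_singleton Ny) (Ws y)) [t [ct Wt] ty]] :=
  sheeted_local_sections y shW.
have tO : \forall y' \near y, N y' -> O (t y').
  by move/within_continuousP : ct; apply; [exact: nbhs_singleton|rewrite ty].
have Nj := lj y N Ny.
suff : \forall y' \near y, O (s y') by [].
near=> y'.
have Ny' : N y' by near: y'.
suff -> : s y' = t y' by move: Ny'; near: y'.
apply: (simply_connected_monodromy sc (y := y')).
apply: path_in_trans (path_in_sym (sP y')) _.
apply: path_in_trans (sP y) _.
have [d [cd Nd d0 d1]] : path_in R N y y' by near: y'.
exists (fun u => (d u, t (d u))); split.
- by apply: continuous_fun_pair => //; exact: (continuous_comp_within cd Nd ct).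
- by move=> u; exact: Wt (Nd u).
- by rewrite d0 ty.
- by rewrite d1.
Unshelve. all: by end_near. Qed.

End Monodromy.

(** * Local path connectedness of polyhedra and their coverings *)

Lemma continuous_ptws (I : Type) (S T : topologicalType) (f : S -> {ptws I -> T}) :
  (forall i, continuous (fun x => f x i)) -> continuous f.
Proof.
move=> cf x; apply/cvg_sup => i.
exact: (@continuous_comp_initial (I -> T) S T (fun g => g i) f (cf i)).
Qed.

Lemma continuous_set_val (T : topologicalType) (A : set T) :
  continuous (val : A -> T).
Proof. exact: initial_continuous. Qed.

Lemma continuous_ptws_val (I : eqType) (T : topologicalType) (A : set {ptws I -> T}) i :
  continuous (fun x : A => val x i).
Proof.
move=> x; apply: (continuous_comp (f := (val : A -> _))
  (g := fun y : {ptws I -> T} => y i)).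
  exact: continuous_set_val.
exact: (@proj_continuous I (fun=> T)).
Qed.

Lemma continuous_set_type (S T : topologicalType) (A : set T) (f : S -> A) :
  continuous (val \o f) -> continuous f.
Proof. by move=> cf; exact: (@continuous_comp_initial A S T val f cf). Qed.

Lemma hausdorff_inj (T Z : topologicalType) (f : T -> Z) :
  continuous f -> injective f -> hausdorff_space Z -> hausdorff_space T.
Proof.
move=> cf injf; rewrite !open_hausdorff => hZ x y xy.
have fxy : f x != f y by apply: contra_neq xy => /injf.
have [[A B] /= [/set_mem Ax /set_mem By] [oA oB AB]] := hZ _ _ fxy.
exists (f @^-1` A, f @^-1` B) => /=; first by split; exact/mem_set.
have cf' := (continuousP f).1 cf.
by split; [exact: cf'|exact: cf'|rewrite -preimage_setI (eqP AB) preimage_set0].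
Qed.

Section LocallyJoinable.
Variable R : realType.

(** Short paths downstairs are carried upstairs by the local inverse [g]; this
    covers homeomorphisms and covering maps alike. *)
Lemma locally_joinable_local_inverse (T Z : topologicalType) (q : T -> Z) :
  continuous q ->
  (forall x, exists (U : set Z) (g : Z -> T), [/\ nbhs (q x) U,
     {within U, continuous g} & \forall x' \near x, g (q x') = x']) ->
  locally_joinable R Z -> locally_joinable R T.
Proof.
move=> cq inv lj x N Nx.
have [U [g [Ux cg gq]]] := inv x; have gqx := nbhs_singleton gq.
pose O := [set z | U z /\ N (g z)].
have Ox : nbhs (q x) O.
  have := (within_continuousP _ _).1 cg _ (nbhs_singleton Ux) N.
  rewrite gqx => /(_ Nx) UN; near=> z.
  have Uz : U z by near: z.
  by split=> //; move: Uz; near: z.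
have qj := cq x _ (lj _ _ Ox).
near=> x'.
have [d [cd Od d0 d1]] : path_in R O (q x) (q x') by near: x'.
have gqx' : g (q x') = x' by near: x'.
exists (g \o d); split.
- by apply: (continuous_comp_within cd _ cg) => t; case: (Od t).
- by move=> t; case: (Od t).
- by rewrite /= d0.
- by rewrite /= d1.
Unshelve. all: by end_near. Qed.

Lemma locally_joinable_homeomorphism (T Z : topologicalType) (h : T -> Z) :
  homeomorphism h -> locally_joinable R Z -> locally_joinable R T.
Proof.
move=> [ch [g [cg hg _]]]; apply: locally_joinable_local_inverse ch _ => x.
exists setT, g; split; first exact: filterT.
  exact: continuous_subspaceT.
exact: nearW.
Qed.

Lemma covering_local_inverse (E X : topologicalType) (p : E -> X) (x : E) :
  covering_map p -> exists (U : set X) (g : X -> E), [/\ nbhs (p x) U,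
     {within U, continuous g}, \forall x' \near x, g (p x') = x' &
     forall z, U z -> p (g z) = z].
Proof.
move=> [cp _ /(_ (p x)) [U [oU Ux [I [V [oV _ VU hV]]]]]].
have [i _ Vx] : (\bigcup_i V i) x by rewrite -VU.
have [_ _ [g [cg _ gp pg]]] := hV i.
exists U, g; split=> //.
- exact: open_nbhs_nbhs.
- apply: filterS (open_nbhs_nbhs (conj (oV i) Vx)) => x' Vx'.
  exact/gp/mem_set.
- by move=> z Uz; exact/pg/mem_set.
Qed.

Lemma locally_joinable_covering (E X : topologicalType) (p : E -> X) :
  covering_map p -> locally_joinable R X -> locally_joinable R E.
Proof.
move=> cov; have [cp _ _] := cov; apply: locally_joinable_local_inverse cp _ => x.
by have [U [g [? ? ? _]]] := covering_local_inverse x cov; exists U, g.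
Qed.

Section Realization.
Variables (V : finType) (K : {set {set V}}).
Hypothesis KP : simplicial_complex K.

Definition seg (x y : {ptws V -> R}) (t : R) : {ptws V -> R} :=
  fun v => (1 - t) * x v + t * y v.

Lemma continuous_seg (x : {ptws V -> R}) :
  continuous (fun z : R * {ptws V -> R} => seg x z.2 z.1).
Proof.
apply: continuous_ptws => v.
have c1 : continuous (@fst R {ptws V -> R}) by move=> z; exact: cvg_fst.
have c2 : continuous (fun z : R * {ptws V -> R} => z.2 v : R).
  move=> z; apply: (continuous_comp (f := @snd R {ptws V -> R})
    (g := fun y : {ptws V -> R} => y v)); first exact: cvg_snd.
  exact: (@proj_continuous V (fun=> R)).
have c3 : continuous (fun z : R * {ptws V -> R} => (1 - z.1) * x v).
  move=> z; apply: (continuous_comp (f := @fst R {ptws V -> R})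
    (g := fun t : R => (1 - t) * x v)); first exact: c1.
  by apply: cvgMl; apply: cvgB; [exact: cvg_cst|exact: cvg_id].
have c4 : continuous (fun z : R * {ptws V -> R} => z.1 * z.2 v).
  by move=> z; exact: cvgM (c1 z) (c2 z).
by move=> z; exact: cvgD (c3 z) (c4 z).
Qed.

(** The weights along the segment vanish wherever those of [y] do, so that the
    segment stays in the closed simplex carrying [y]. *)
Lemma seg_realization (x y : {ptws V -> R}) (t : R) : `[0, 1] t ->
  (forall v, y v = 0 -> x v = 0) ->
  realization R K x -> realization R K y -> realization R K (seg x y t).
Proof.
rewrite /= in_itv /= => /andP[t0 t1] yx [x0 x1 Kx] [y0 y1 Ky].
have s1 : \sum_(v : V) seg x y t v = 1.
  by rewrite big_split /= -!mulr_sumr x1 y1 !mulr1 subrK.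
split=> //.
  by move=> v; rewrite addr_ge0 // mulr_ge0 // subr_ge0.
have [_ _ sub] := KP; apply: sub Ky _ _.
  apply: contra_eq_neq s1 => s0; rewrite big1 1?eq_sym ?oner_neq0 // => v _.
  apply/eqP; apply: contraT => nz.
  suff : v \in finset.set0 by rewrite finset.in_set0.
  by rewrite -s0 finset.inE.
apply/fintype.subsetP => v; rewrite !finset.inE; apply: contra_neq => yv.
by rewrite /seg yv (yx _ yv) !mulr0 addr0.
Qed.

(** Every point [y] near [x] has nonzero weight where [x] has, so that the
    segment from [x] to [y] lies in the realization; it stays close to [x]
    by compactness of [`[0, 1]] (tube lemma). *)
Lemma locally_joinable_realization : locally_joinable R (realization R K).
Proof.
move=> x N [B [[M oM <-] Mx MN]].
have supp1 v : \forall y \near x, val y v = 0 -> val x v = 0.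
  have [xv|xv] := eqVneq (val x v) 0; first by near=> y.
  have nz : nbhs (val x v) [set r : R | r != 0].
    by apply: open_nbhs_nbhs; split=> //; exact: open_neq.
  have nzy : \forall y \near x, val y v != 0.
    exact: (@continuous_ptws_val V R (realization R K) v x _ nz).
  by apply: filterS nzy => y /eqP.
have supp : \forall y \near x, forall v, val y v = 0 -> val x v = 0.
  exact: (@filter_forall _ V (fun v (y : realization R K) =>
    val y v = 0 -> val x v = 0) (nbhs x) _ supp1).
have tube : \forall y \near x, `[0, 1] `<=` (fun t => M (seg (val x) (val y) t)).
  have cov := (compact_near_coveringP _).1 (@segment_compact R 0 1).
  apply: (cov _ (nbhs x) (fun (y : realization R K) t =>
    M (seg (val x) (val y) t)) _) => t _.
  have segx : seg (val x) (val x) t = val x.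
    by apply/funext => v; rewrite /seg -mulrDl subrK mul1r.
  pose j (z : R * realization R K) : R * {ptws V -> R} := (z.1, val z.2).
  have cj : continuous j.
    apply: continuous_fun_pair => z; first exact: cvg_fst.
    by apply: continuous_comp; [exact: cvg_snd|exact: continuous_set_val].
  have cS : {for (t, x), continuous
      ((fun z : R * {ptws V -> R} => seg (val x) z.2 z.1) \o j)}.
    by apply: continuous_comp; [exact: cj|exact: continuous_seg].
  have := cS M; rewrite /= segx; apply.
  by apply: open_nbhs_nbhs.
near=> y.
have xP : realization R K (val x) by exact: set_valP.
have yP : realization R K (val y) by exact: set_valP.
have suppy : forall v, val y v = 0 -> val x v = 0 by near: y.
have tubey : `[0, 1] `<=` (fun t => M (seg (val x) (val y) t)) by near: y.
pose d (t : R) : realization R K := exist _ (seg (val x) (val y) (clamp t))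
  (mem_set (seg_realization (clamp_itv t) suppy xP yP)).
exists d; split.
- apply: continuous_set_type.
  apply: (continuous_comp_within (f := @clamp R) (A := setT) (g := seg (val x) (val y))) => //.
    exact: continuous_clamp.
  apply: continuous_subspaceT => t.
  apply: (continuous_comp (f := fun t : R => (t, val y : {ptws V -> R}))
    (g := fun z : R * {ptws V -> R} => seg (val x) z.2 z.1)); last exact: continuous_seg.
  exact: cvg_pair (@cvg_id _ _) (cvg_cst _).
- by move=> t; apply: MN; apply: tubey; exact: clamp_itv.
- apply: val_inj => /=; rewrite clamp0; apply/funext => v.
  by rewrite /seg subr0 mul1r mul0r addr0.
- apply: val_inj => /=; rewrite clamp1; apply/funext => v.
  by rewrite /seg subrr mul0r mul1r add0r.
Unshelve. all: by end_near. Qed.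

End Realization.

Lemma hausdorff_realization (V : finType) (K : {set {set V}}) :
  hausdorff_space (realization R K).
Proof.
apply: (@hausdorff_inj (realization R K) {ptws V -> R} (fun x => val x)).
- exact: continuous_set_val.
- exact: val_inj.
- apply: (@hausdorff_product V (fun=> R)) => _; exact: Rhausdorff.
Qed.

End LocallyJoinable.

(** * Lifting an n-valued map through a covering *)

(** The sheets over [U] recorded as a set of subsets of [E]: unlike an indexed
    family, it can label the sheets over all open sets by a single type. *)
Definition sheet_family (E X : topologicalType) (q : E -> X) (U : set X)
    (S : set (set E)) : Prop :=
  [/\ forall V, S V -> open V,
      forall V V' e, S V -> S V' -> V e -> V' e -> V = V',
      forall e, U (q e) -> exists2 V, S V & V e,
      forall V x, S V -> U x -> exists2 e, V e & q e = x &
      forall V e e', S V -> V e -> V e' -> q e = q e' -> e = e'].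

Lemma evenly_covered_sheets (E X : topologicalType) (q : E -> X) (U : set X) :
  evenly_covered q U -> exists S, sheet_family q U S.
Proof.
move=> [I [V [oV Vdisj VU hV]]]; exists (range V); split.
- by move=> _ [i _ <-].
- move=> _ _ e [i _ <-] [j _ <-] Vi Vj; congr V.
  by apply: Vdisj => //; exists e.
- move=> e; have -> : U (q e) = (\bigcup_i V i) e by rewrite -VU.
  by move=> [i _ Vi]; exists (V i) => //; exists i.
- move=> _ x [i _ <-] Ux; have [_ _ [g [_ gV _ qg]]] := hV i.
  by exists (g x); [exact: gV|apply: qg; exact/mem_set].
- move=> _ e e' [i _ <-] Ve Ve' qe; have [_ _ [g [_ _ gq _]]] := hV i.
  by rewrite -(gq e) ?qe ?gq //; exact/mem_set.
Qed.

Section NValued.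
Variables (n : nat) (X : topologicalType).

Lemma points_enum (A : unordered_config n X) :
  exists u : 'I_n -> X, injective u /\ points A = range u.
Proof.
have /card_set_bijP [g [gA ginj gsurj]] : (points A #= `I_n)%card.
  exact: set_mem (valP A).
have /choice [u uP] : forall i : 'I_n, exists x, points A x /\ g x = i.
  by move=> i; have [x Ax gx] := gsurj _ (ltn_ord i); exists x.
exists u; split.
  by move=> i j uij; apply: val_inj; rewrite /= -(uP i).2 uij (uP j).2.
rewrite eqEsubset; split=> [x Ax|_ [i _ <-]]; last by case: (uP i).
have gx : (g x < n)%N by exact: gA Ax.
exists (Ordinal gx) => //; have [Au gu] := uP (Ordinal gx).
by apply: ginj; rewrite ?inE.
Qed.

(** An injection into an [n]-element set from ['I_n] is onto. *)
Lemma points_range (A : unordered_config n X) (u : 'I_n -> X) :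
  injective u -> (forall i, points A (u i)) -> points A = range u.
Proof.
move=> uinj uA; have [v [vinj vA]] := points_enum A.
have /choice [k kP] : forall i, exists j, v j = u i.
  by move=> i; have := uA i; rewrite vA => -[j _ <-]; exists j.
have kinj : injective k by move=> i j kij; apply: uinj; rewrite -!kP kij.
rewrite eqEsubset; split=> [x|_ [i _ <-] //]; rewrite vA => -[j _ <-].
by have /codomP [i ->] := injF_onto kinj j; exists i.
Qed.

(** The configurations meeting a given open set form an open set, as is seen on
    ordered configurations.  The continuity of an [n]-valued map enters the proof
    through this fact alone. *)
Lemma near_points (A : unordered_config n X) x (O : set X) :
  points A x -> nbhs x O -> \forall B \near A, exists2 z, points B z & O z.
Proof.
rewrite nbhsE => Ax [V [oV Vx] VO].
pose U := [set B : unordered_config n X | exists2 z, points B z & V z].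
have oU : open U.
  have : open (\bigcup_(i : 'I_n) [set c : config n X | V (val c i)]).
    apply: bigcup_open => i _.
    exact: ((continuousP _).1 (@continuous_ptws_val _ X (config n X) i) _ oV).
  congr open; rewrite eqEsubset; split=> [c [i _ ci]|c [z [i _ <-] cz]].
    by exists (val c i) => //; exists i.
  by exists i.
have UA : U A by exists x.
have nU := open_nbhs_nbhs (conj oU UA).
by apply: filterS nU => C [z Cz /VO]; exists z.
Qed.

Lemma disjoint_nbhs (u : 'I_n -> X) (U : 'I_n -> set X) :
  hausdorff_space X -> injective u -> (forall i, nbhs (u i) (U i)) ->
  exists O : 'I_n -> set X, [/\ forall i, open (O i), forall i, O i (u i),
    forall i, O i `<=` U i & forall i j x, O i x -> O j x -> i = j].
Proof.
rewrite open_hausdorff => hX uinj uU.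
have /choice [P PP] : forall ij : 'I_n * 'I_n, exists AB : set X * set X,
    [/\ nbhs (u ij.1) AB.1, nbhs (u ij.2) AB.2 &
        ij.1 != ij.2 -> forall x, AB.1 x -> ~ AB.2 x].
  (* Trivial neighbourhoods on the diagonal, where nothing is separated. *)
  move=> [i j] /=; have [ij|ij] := eqVneq i j.
    by exists (setT, setT); split=> //; exact: filterT.
  have uij : u i != u j by apply: contra_neq ij => /uinj.
  have [[A B] /= [/set_mem Ai /set_mem Bj] [oA oB AB]] := hX _ _ uij.
  exists (A, B); split; [exact: open_nbhs_nbhs|exact: open_nbhs_nbhs|].
  by move=> _ x Ax Bx; have /seteqP [AB0 _] := eqP AB; exact: (AB0 x).
pose Q i := [set x | U i x /\ forall j, (P (i, j)).1 x /\ (P (j, i)).2 x].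
have nQ i : nbhs (u i) (Q i).
  apply: filterI => //.
  apply: (@filter_forall _ _ (fun j x => (P (i, j)).1 x /\ (P (j, i)).2 x) _ _) => j.
  by apply: filterI; [case: (PP (i, j))|case: (PP (j, i))].
exists (fun i => interior (Q i)); split.
- by move=> i; exact: open_interior.
- by [].
- by move=> i x /interior_subset [].
- move=> i j x /interior_subset [_ Qi] /interior_subset [_ Qj].
  apply/eqP; apply/negP => /negP ij; have [_ _ /(_ ij x)] := PP (i, j).
  by apply; [case: (Qi j)|case: (Qj i)].
Qed.

(** If [O] are disjoint open neighbourhoods of the points of [f y], then for [y']
    near [y] each of them meets [f y'], hence in exactly one point by counting;
    the label of [e] records which of these sets contains [q e] and
    which of the sheets over it contains [e]. *)
Lemma sheeted_lift_relation (Y E : topologicalType) (q : E -> X)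
    (f : Y -> unordered_config n X) :
  hausdorff_space X -> covering_map q -> continuous f ->
  sheeted (fun y e => points (f y) (q e)).
Proof.
move=> hX cov cf; have [cq _ evenly] := cov; split=> [y e O fye eO|y].
  have [U [g [Ux /within_continuousP cg gq qg]]] := covering_local_inverse e cov.
  have gO : nbhs (q e) [set z | U z /\ O (g z)].
    have := cg _ (nbhs_singleton Ux) O; rewrite (nbhs_singleton gq) => /(_ eO) UO.
    by apply: filterS (filterI Ux UO) => z [Uz /(_ Uz)].
  have near_z : \forall y' \near y, exists2 z, points (f y') z & U z /\ O (g z).
    exact: cf y _ (near_points fye gO).
  by apply: filterS near_z => y' [z fz [Uz Oz]]; exists (g z); rewrite ?qg.
have [u [uinj uE]] := points_enum (f y).
have /choice [U UP] : forall x : X, exists U : set X,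
    nbhs x U /\ exists S, sheet_family q U S.
  move=> x; have [U [oU Ux /evenly_covered_sheets hU]] := evenly x.
  by exists U; split=> //; exact: open_nbhs_nbhs.
have [|O [oO Ou OU Odisj]] := @disjoint_nbhs u (fun i => U (u i)) hX uinj.
  by move=> i; exact: (UP (u i)).1.
have /choice [S SP] : forall i, exists S, sheet_family q (U (u i)) S.
  by move=> i; exact: (UP (u i)).2.
pose N := [set y' | forall i, exists2 z, points (f y') z & O i z].
have Ny : nbhs y N.
  apply: (@filter_forall _ _ (fun i y' => exists2 z, points (f y') z & O i z) _ _) => i.
  have fyu : points (f y) (u i) by rewrite uE; exists i.
  exact: (cf y _ (near_points fyu (open_nbhs_nbhs (conj (oO i) (Ou i))))).
have pN y' : N y' -> exists v : 'I_n -> X, points (f y') = range v /\ forall i, O i (v i).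
  move=> Ny'; have /choice [v vP] : forall i, exists z, points (f y') z /\ O i z.
    by move=> i; have [z] := Ny' i; exists z.
  exists v; split=> [|i]; last by case: (vP i).
  apply: points_range => [i j vij|i]; last by case: (vP i).
  by apply: (Odisj i j (v i)); [case: (vP i)|rewrite vij; case: (vP j)].
pose l e := [set iV : 'I_n * set E | [/\ O iV.1 (q e), S iV.1 iV.2 & iV.2 e]].
(* A label holds at most one pair, as the [O i] and the sheets are disjoint. *)
have lE e e' i V : O i (q e) -> O i (q e') -> S i V -> V e -> V e' -> l e' = l e.
  wlog suff H : e e' / O i (q e) -> O i (q e') -> S i V -> V e -> V e' -> l e' `<=` l e.
    by move=> *; rewrite eqEsubset; split; exact: H.
  move=> Oe Oe' SV Ve Ve' [j V'] [/= Oj SV' V'e'].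
  have ij := Odisj _ _ _ Oj Oe'; rewrite {}ij in Oj SV' *.
  have [_ Sdisj _ _ _] := SP i.
  by rewrite /l /= (Sdisj _ _ _ SV' SV V'e' Ve').
have lex e y' : N y' -> points (f y') (q e) ->
    exists i V, [/\ O i (q e), S i V & V e].
  move=> /pN [v [vE Ov]]; rewrite vE => -[i _ vi].
  have Oi : O i (q e) by rewrite -vi.
  have [_ _ cover _ _] := SP i.
  by have [V SV Ve] := cover e (OU _ _ Oi); exists i, V.
exists N, (set ('I_n * set E)), l; split=> //.
- move=> y' e Ny' /(lex _ _ Ny') [i [V [Oi SV Ve]]].
  have [oS _ _ _ _] := SP i.
  have nO : nbhs e (q @^-1` O i) by apply: cq; exact: open_nbhs_nbhs.
  have nV : nbhs e V by apply: open_nbhs_nbhs; split=> //; exact: oS.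
  by apply: filterS (filterI nO nV) => e' [Oe' Ve']; exact: (lE _ _ i V).
- move=> y' e y'' Ny' Ny'' /(lex _ _ Ny') [i [V [Oi SV Ve]]].
  have [v [vE Ov]] := pN _ Ny''; have [_ _ _ surj _] := SP i.
  have [e' Ve' qe'] := surj _ _ SV (OU _ _ (Ov i)).
  exists e'; first by rewrite qe' vE; exists i.
  by apply: (lE _ _ i V) => //; rewrite qe'.
- move=> y' e e' Ny' We We' ll.
  have [i [V [Oi SV Ve]]] := lex _ _ Ny' We.
  have [/= Oi' _ Ve'] : l e' (i, V) by rewrite -ll.
  have [_ _ _ _ inj] := SP i; apply: (inj _ _ _ SV Ve Ve').
  have [v [vE Ov]] := pN _ Ny'; move: We We' Oi Oi'; rewrite vE => -[j _ <-] [k _ <-].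
  by move=> /(Odisj _ _ _ (Ov j)) -> /(Odisj _ _ _ (Ov k)) ->.
Qed.

End NValued.

(** * Fixed points and lift-factors *)

Lemma covering_id (X : topologicalType) : covering_map (@id X).
Proof.
split=> [x|x _|x]; [exact: cvg_id|by exists x|].
exists setT; split=> //; first exact: openT.
exists unit, (fun=> setT); split.
- by move=> _; exact: openT.
- by move=> [] [].
- by rewrite eqEsubset; split=> // y _; exists tt.
- move=> _; split=> //; first by apply: continuous_subspaceT => y; exact: cvg_id.
  by exists id; split=> //; apply: continuous_subspaceT => y; exact: cvg_id.
Qed.

(** The distinctness clause of the orbit configuration space follows from the
    distinctness of the projections, as covering transformations preserve the
    fibres of [p]. *)
Lemma lifting_of_sections (n : nat) (E X : topologicalType) (p : E -> X)
    (f : X -> unordered_config n X) (s : 'I_n -> E -> E) :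
  (forall i, continuous (s i)) ->
  (forall i y, points (f (p y)) (p (s i y))) ->
  (forall y, injective (fun i => p (s i y))) ->
  exists2 fbar : E -> orbit_config n p, lifting f fbar &
    forall y i, val (fbar y) i = s i y.
Proof.
move=> cs sf sinj.
have so y : orbit_config n p (fun i => s i y).
  move=> i j a ij [_ pa] sa; move/eqP: ij; apply; apply: (sinj y).
  by rewrite /= sa -[in RHS]pa.
exists (fun y => exist _ (fun i => s i y) (mem_set (so y))) => //.
split; first by apply: continuous_set_type; apply: continuous_ptws => i; exact: cs.
by move=> y; rewrite (points_range (sinj y) (sf^~ y)).
Qed.

Theorem theorem2p8 (R : realType) (X Xt : topologicalType) (p : Xt -> X)
    (n : nat) (f : X -> unordered_config n X) :
  finite_polyhedron R X ->
  connected [set: X] ->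
  universal_covering R p ->
  (1 <= n)%N ->
  continuous f ->
  Fix_multi f = \bigcup_(g in lift_factors p f) (p @` Fix g).
Proof.
move=> [V [K [KP [h hh]]]] _ [cov sc] _ cf.
have [ch [h' [_ hK _]]] := hh; have [cp psurj _] := cov.
have hX : hausdorff_space X.
  by apply: (hausdorff_inj ch (can_inj hK)); exact: hausdorff_realization.
have ljXt : locally_joinable R Xt.
  apply: (locally_joinable_covering cov); apply: (locally_joinable_homeomorphism hh).
  exact: locally_joinable_realization.
have cfp : continuous (f \o p).
  by move=> y; apply: continuous_comp; [exact: cp|exact: cf].
have shW := sheeted_lift_relation hX cov cfp.
have shX := sheeted_lift_relation hX (@covering_id X) cfp.
rewrite eqEsubset; split=> [x fx|_ [_ [fbar [i [[_ fbarE] ->]]] [y fixy <-]]]; last first.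
  by rewrite /Fix_multi /= -fbarE; exists i => //; congr p.
have [y0 _ py0] := psurj x Logic.I; rewrite -{x}py0 in fx *.
have [u [uinj uE]] := points_enum (f (p y0)).
have [i0 _ ui0] : range u (p y0) by rewrite -uE.
have /choice [e eP] : forall i, exists e, p e = u i /\ (i = i0 -> e = y0).
  move=> i; have [->|ii0] := eqVneq i i0; first by exists y0.
  have [e _ pe] := psurj (u i) Logic.I.
  by exists e; split=> // ii; rewrite ii eqxx in ii0.
have /choice [s sP] : forall i, exists s : Xt -> Xt,
    [/\ continuous s, forall y, points (f (p y)) (p (s y)) & s y0 = e i].
  move=> i; apply: (global_section shW sc ljXt).
  by rewrite /= (eP i).1 uE; exists i.
have cs i : continuous (s i) by case: (sP i).
have sf i y : points (f (p y)) (p (s i y)) by case: (sP i).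
have s0 i : s i y0 = e i by case: (sP i).
have cps i : continuous (p \o s i).
  by move=> y; apply: continuous_comp; [exact: cs|exact: cp].
have sinj y : injective (fun i => p (s i y)).
  move=> i j sij; apply: uinj; rewrite -(eP i).1 -(eP j).1 -!s0.
  have [_ pc _] := sc.
  exact: (global_section_unique (s := p \o s i) (t := p \o s j) shX y0 pc
    (cps i) (cps j) (sf i) (sf j) sij).
have [fbar fbarL fbarE] := lifting_of_sections cs sf sinj.
exists (fun y => val (fbar y) i0); first by exists fbar, i0.
by exists y0 => //; rewrite /Fix /= fbarE s0 (eP i0).2.
Qed.
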